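(* Let $G$ be a connected graph with $m$ edges and incidence matrix $B$, equip $\mathbb{R}^m$ with the Euclidean edge inner product, and let $\mathbb{R}^m=\mathcal{C}\oplus\mathcal{H}$, $\mathcal{C}=\operatorname{im}B^\top$, $\mathcal{H}=\ker B$, be the resulting orthogonal cut--cycle decomposition, with orthogonal projections $P_C$ onto $\mathcal{C}$ and $P_H$ onto $\mathcal{H}$. Let $f_*\in\mathcal{C}$ be a prescribed (constant) transfer flow and let $\alpha,\kappa>0$. Consider a solution $f(t)\in\mathbb{R}^m$ of $$\dot f=-\alpha P_C(f-f_* )-\kappa P_Hf .$$ Write $f=f_C+f_H$ with $f_C=P_Cf\in\mathcal{C}$ and $f_H=P_Hf\in\mathcal{H}$. Then $$f_C(t)-f_*=e^{-\alpha t}\bigl(f_C(0)-f_*\bigr)\qquad\text{and}\qquad f_H(t)=e^{-\kappa t}f_H(0).$$ In particular, the harmonic loop-flow component $f_H$ is exponentially damped without disturbing the prescribed cut-space target $f_*$.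
   Context: $G=(V,E)$ is a finite connected graph with $n=|V|$, $m=|E|$, and a fixed reference orientation of each edge. The incidence matrix $B\in\mathbb{R}^{n\times m}$ has, in the column of each oriented edge, entry $+1$ at the tail and $-1$ at the head (all other entries $0$). The cut space is $\mathcal{C}=\operatorname{im}B^\top\subset\mathbb{R}^m$ and the harmonic cycle space is $\mathcal{H}=\ker B\subset\mathbb{R}^m$; they are orthogonal complements in the Euclidean inner product. *)

(* Defs.v *)
From HB Require Import structures.
From mathcomp Require Import all_boot all_order all_algebra.
From mathcomp Require Import all_classical all_reals all_analysis.
From mathcomp Require Import ring lra zify.

Set Implicit Arguments.
Unset Strict Implicit.
Unset Printing Implicit Defensive.

Import Order.TTheory GRing.Theory Num.Theory.
Import numFieldNormedType.Exports.
Local Open Scope classical_set_scope.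
Local Open Scope ring_scope.

(* A graph on the vertices 'I_n with edges 'I_m, the edge e being oriented from
   [tail e] to [head e].  Parallel edges are allowed; simple graphs are the
   special case where distinct edges have distinct sets of end points. *)
Record orgraph (n m : nat) := OrGraph {
  tail : 'I_m -> 'I_n ;
  head : 'I_m -> 'I_n ;
  tail_neq_head : forall e, tail e != head e }.

(* adjacency and connectedness ignore the reference orientation *)
Definition adjacent n m (G : orgraph n m) : rel 'I_n := fun u v =>
  [exists e, ((tail G e == u) && (head G e == v)) ||
             ((tail G e == v) && (head G e == u))].

Definition connected_graph n m (G : orgraph n m) : Prop :=
  (0 < n)%N /\ forall u v, connect (adjacent G) u v.

Definition incidence (R : realType) n m (G : orgraph n m) : 'M[R]_(n, m) :=
  \matrix_(v < n, e < m)
    if v == tail G e then 1 else if v == head G e then -1 else 0.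

Definition cut_space (R : realType) n m (G : orgraph n m) : set 'cV[R]_m :=
  range (fun p : 'cV[R]_n => (incidence R G)^T *m p).

Definition harmonic_space (R : realType) n m (G : orgraph n m) :
  set 'cV[R]_m := [set f | incidence R G *m f = 0].

Definition edge_dot (R : realType) m (f g : 'cV[R]_m) : R :=
  \sum_(e < m) f e 0 * g e 0.

(* MathComp-Analysis' norm `|f| on 'cV[R]_m is the sup norm. *)
Definition edge_norm (R : realType) m (f : 'cV[R]_m) : R :=
  Num.sqrt (edge_dot f f).

Definition is_orthproj (R : realType) m (S : set 'cV[R]_m)
    (x y : 'cV[R]_m) : Prop :=
  S y /\ forall s, S s -> edge_dot (x - y) s = 0.

(* [get] picks an element of the set; [cut_harmonic_exists] and
   [cut_harmonic_decomposition] below give existence and uniqueness on the two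
   spaces used here. *)
Definition orthproj (R : realType) m (S : set 'cV[R]_m)
  (x : 'cV[R]_m) : 'cV[R]_m := get (is_orthproj S x).

Definition cut_proj (R : realType) n m (G : orgraph n m) :=
  orthproj (@cut_space R n m G).

Definition harmonic_proj (R : realType) n m (G : orgraph n m) :=
  orthproj (@harmonic_space R n m G).

(* f solves f' = - alpha P_C (f - fstar) - kappa P_H f on the interval J: it is
   continuous on J and satisfies the equation in the interior of J, so that a
   solution on [0, +oo[ need not have a two-sided derivative at 0. *)
Definition loop_damping_solution (R : realType) n m (G : orgraph n m)
    (alpha kappa : R) (fstar : 'cV[R]_m) (J : interval R)
    (f : R -> 'cV[R]_m) : Prop :=
  {within [set` J], continuous f} /\
  forall t : R, [set` J]° t ->
    is_derive t 1 f (- (alpha *: cut_proj G (f t - fstar))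
                     - kappa *: harmonic_proj G (f t)).

Lemma edge_dotE (R : realType) m (f g : 'cV[R]_m) :
  edge_dot f g = (f^T *m g) 0 0.
Proof. by rewrite mxE; apply: eq_bigr => e _; rewrite mxE. Qed.

Lemma edge_dot_eq0 (R : realType) m (f : 'cV[R]_m) : edge_dot f f = 0 -> f = 0.
Proof.
move=> /eqP; rewrite psumr_eq0 => [/allP f0|e _]; last by rewrite -expr2 sqr_ge0.
apply/colP => e; rewrite mxE; apply/eqP.
by have := f0 e (mem_index_enum e); rewrite /= mulf_eq0 orbb.
Qed.

Lemma cut_harmonic_orthogonal (R : realType) n m (G : orgraph n m)
    (c h : 'cV[R]_m) :
  cut_space G c -> harmonic_space G h -> edge_dot c h = 0.
Proof.
move=> [p _ <-] hh.
by rewrite edge_dotE trmx_mul trmxK -mulmxA hh mulmx0 mxE.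
Qed.

Lemma cut_harmonic_exists (R : realType) n m (G : orgraph n m)
    (x : 'cV[R]_m) :
  exists c h, [/\ cut_space G c, harmonic_space G h & x = c + h].
Proof.
set B := incidence R G.
have kerB : (kermx (B *m B^T) <= kermx B)%MS.
  apply/rV_subP => v /sub_kermxP vBB; apply/sub_kermxP.
  apply: trmx_inj; rewrite trmx0; apply: edge_dot_eq0.
  rewrite edge_dotE trmxK trmx_mul mulmxA -(mulmxA v B) vBB mul0mx.
  by rewrite mxE.
have rkB : (\rank B^T <= \rank (B *m B^T))%N.
  rewrite mxrank_tr; have := mxrankS kerB; rewrite !mxrank_ker.
  have := rank_leq_row B; have := rank_leq_row (B *m B^T); lia.
have /submxP[p pE] : (x^T *m B^T <= B *m B^T)%MS.
  apply: submx_trans (submxMl _ _) _.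
  by rewrite -(geq_leqif (mxrank_leqif_sup (submxMl _ _))).
exists (B^T *m p^T), (x - B^T *m p^T); split; last by rewrite addrC subrK.
- by exists p^T.
- rewrite /harmonic_space /= -/B mulmxBr mulmxA; apply/eqP; rewrite subr_eq0.
  by apply/eqP/trmx_inj; rewrite !trmx_mul pE !trmxK.
Qed.

Lemma orthprojE (R : realType) m (S : set 'cV[R]_m) (x y : 'cV[R]_m) :
  (forall u v, S u -> S v -> S (u - v)) ->
  is_orthproj S x y -> orthproj S x = y.
Proof.
move=> SB [Sy yP]; have [Sz zP] : is_orthproj S x (orthproj S x).
  by apply: getPex; exists y.
apply/eqP; rewrite -subr_eq0; apply/eqP/edge_dot_eq0.
set d := orthproj S x - y.
have Sd : S d by exact: SB.
have -> : edge_dot d d = edge_dot (x - y) d - edge_dot (x - orthproj S x) d.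
  rewrite /edge_dot -sumrB; apply: eq_bigr => e _.
  by rewrite -mulrBl !mxE; ring.
by rewrite yP// zP// subrr.
Qed.

Lemma cut_harmonic_decomposition (R : realType) n m (G : orgraph n m)
    (c h : 'cV[R]_m) : cut_space G c -> harmonic_space G h ->
  cut_proj G (c + h) = c /\ harmonic_proj G (c + h) = h.
Proof.
move=> cC hH; split; apply: orthprojE.
- by move=> _ _ [p _ <-] [q _ <-]; exists (p - q) => //; rewrite mulmxBr.
- split=> // s sC; rewrite [c + h]addrC addrK /edge_dot.
  under eq_bigr do rewrite mulrC.
  exact: cut_harmonic_orthogonal sC hH.
- move=> u v; rewrite /harmonic_space /= mulmxBr => -> ->.
  by rewrite subrr.
- by split=> // s sH; rewrite addrK; exact: cut_harmonic_orthogonal cC sH.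
Qed.

(* Main.v *)
Require Import Defs.
From mathcomp Require Import all_boot all_order all_algebra.
From mathcomp Require Import all_classical all_reals all_analysis.
From mathcomp Require Import ring.

Import Order.TTheory GRing.Theory Num.Theory.
Import numFieldNormedType.Exports.
Local Open Scope classical_set_scope.
Local Open Scope ring_scope.

(** The equation decouples when it is tested against vectors of the two
    spaces.  If [s] lies in the cut space, then [s] is orthogonal to [P_H f] and
    pairs with [P_C (f - fstar)] as it does with [f - fstar], so the scalar
    function [g t = <f t - fstar, s>] satisfies [g' = - alpha g]; if [s] lies in
    the harmonic space, then it is orthogonal to every cut vector and
    [g t = <f t, s>] satisfies [g' = - kappa g].  A scalar solution of
    [g' = - k g] is [expR (- (k * t)) * g 0] ([exponential_decay]), and a vector
    of a subspace is determined by its pairings with that subspace.  Hence each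
    orthogonal component decays at its own rate ([orthproj_decay]).  The target
    [fstar] is its own cut projection, so the cut component of [f - fstar] is
    [P_C f - fstar].  Working with pairings makes it unnecessary to
    differentiate the projections themselves. *)

Lemma edge_dotC {R : realType} {m} (x y : 'cV[R]_m) :
  edge_dot x y = edge_dot y x.
Proof. by apply: eq_bigr => e _; rewrite mulrC. Qed.

Lemma edge_dotDl {R : realType} {m} (x y s : 'cV[R]_m) :
  edge_dot (x + y) s = edge_dot x s + edge_dot y s.
Proof. by rewrite -big_split; apply: eq_bigr => e _; rewrite mxE mulrDl. Qed.

Lemma edge_dotZl {R : realType} {m} (a : R) (x s : 'cV[R]_m) :
  edge_dot (a *: x) s = a * edge_dot x s.
Proof. by rewrite mulr_sumr; apply: eq_bigr => e _; rewrite mxE mulrA. Qed.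

Lemma edge_dotNl {R : realType} {m} (x s : 'cV[R]_m) :
  edge_dot (- x) s = - edge_dot x s.
Proof. by rewrite -scaleN1r edge_dotZl mulN1r. Qed.

Lemma edge_dotBl {R : realType} {m} (x y s : 'cV[R]_m) :
  edge_dot (x - y) s = edge_dot x s - edge_dot y s.
Proof. by rewrite edge_dotDl edge_dotNl. Qed.

Lemma edge_normZ {R : realType} {m} (a : R) (x : 'cV[R]_m) :
  edge_norm (a *: x) = `|a| * edge_norm x.
Proof.
rewrite /edge_norm edge_dotZl edge_dotC edge_dotZl mulrA -expr2.
by rewrite sqrtrM ?sqr_ge0// sqrtr_sqr.
Qed.

Lemma edge_dot_orthproj {R : realType} {m} {S : set 'cV[R]_m} {x y s} :
  is_orthproj S x y -> S s -> edge_dot y s = edge_dot x s.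
Proof.
by move=> [_ /[apply]] /eqP; rewrite edge_dotBl subr_eq0 => /eqP.
Qed.

Lemma edge_dot_continuous {R : realType} {m} (s : 'cV[R]_m) :
  continuous (fun x : 'cV[R]_m => edge_dot x s).
Proof.
apply: continuous_big => [|e _ x]; first exact: add_continuous.
exact: (continuous_comp (@coord_continuous R m 1 e 0 x)
                        (@mulrr_continuous R (s e 0) _)).
Qed.

Lemma is_derive_edge_dot {R : realType} {m} (x : R -> 'cV[R]_m) dx s (t : R) :
  is_derive t 1 x dx ->
  is_derive t 1 (fun u => edge_dot (x u) s) (edge_dot dx s).
Proof.
move=> [xt dxE]; have xij := (derivable_mxP x t 1).1 xt.
have -> : (fun u => edge_dot (x u) s) =
    \sum_(e < m) (s e 0 *: (fun u => x u e 0)).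
  by apply/funext => u; rewrite fct_sumE; apply: eq_bigr => e _; rewrite mulrC.
have -> : edge_dot dx s = \sum_(e < m) (s e 0 *: dx e 0).
  by apply: eq_bigr => e _; rewrite mulrC.
apply: is_derive_sum => e; apply: is_deriveZ; split; first exact: xij.
by rewrite -dxE derive_mx// mxE.
Qed.

(** The mean value theorem asks for a derivative only between the two points, so
    continuity carries the conclusion to the end points of [J]. *)
Lemma derive0_constant {R : realType} {J : interval R} {h : R -> R} :
  {within [set` J], continuous h} ->
  (forall t, [set` J]° t -> is_derive t 1 h 0) ->
  forall a b, a \in J -> b \in J -> h a = h b.
Proof.
move=> hc hd a b; wlog ab : a b / a <= b => [th aJ bJ|aJ bJ].
  by case/orP: (le_total a b) => ?; [|symmetry]; apply: th.
have abJ : [set` `[a, b]] `<=` [set` J].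
  by move=> x /=; exact: interval_is_interval aJ bJ _.
have [||c _] := @MVT_segment _ h (fun=> 0) a b ab.
- move=> x xab; apply: hd.
  have : [set` `]a, b[]° x by rewrite interior_itv.
  by apply: interiorS; apply: subset_trans abJ; exact: subset_itv_oo_cc.
- exact: continuous_subspaceW abJ hc.
- by rewrite mul0r => /eqP; rewrite subr_eq0 => /eqP.
Qed.

(** The integrating factor [expR (k * t)] turns the solution into a function
    with zero derivative. *)
Lemma exponential_decay {R : realType} {k : R} {J : interval R} {g : R -> R} :
  0 \in J -> {within [set` J], continuous g} ->
  (forall t, [set` J]° t -> is_derive t 1 g (- k * g t)) ->
  forall t, t \in J -> g t = expR (- (k * t)) * g 0.
Proof.
move=> J0 gc gd t tJ.
pose E : R -> R := fun u => expR (k * u).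
have Ed (u : R) : is_derive u 1 E (k * E u).
  have ? : is_derive u 1 (fun v : R => k * v) k.
    by rewrite -[X in is_derive _ _ _ X]mulr1; exact: is_deriveZ.
  by rewrite mulrC; exact: (@is_derive1_comp _ expR).
have Ec : continuous E.
  by move=> u; apply/differentiable_continuous/derivable1_diffP; case: (Ed u).
have hc : {within [set` J], continuous (E * g)}.
  by move=> u; apply: cvgM; [exact: (continuous_subspaceT Ec)|exact: gc].
have hd (u : R) : [set` J]° u -> is_derive u 1 (E * g) 0.
  move=> /gd ?; apply: is_derive_eq; rewrite /GRing.scale /=; ring.
have : E t * g t = E 0 * g 0 := derive0_constant hc hd t 0 tJ J0.
rewrite {2}/E mulr0 expR0 mul1r => <-.
by rewrite mulrA -expRD addNr expR0 mul1r.
Qed.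

(** Only the pairings of [dx] with [S] matter: the difference of the two sides
    lies in [S] and is orthogonal to all of [S], hence to itself. *)
Lemma orthproj_decay {R : realType} {m} {S : set 'cV[R]_m} {k : R}
    {J : interval R} {x y : R -> 'cV[R]_m} :
  (forall a u v, S u -> S v -> S (u - a *: v)) ->
  (forall t, is_orthproj S (x t) (y t)) ->
  0 \in J -> {within [set` J], continuous x} ->
  (forall t, [set` J]° t -> exists2 dx, is_derive t 1 x dx &
     forall s, S s -> edge_dot dx s = - k * edge_dot (x t) s) ->
  forall t, t \in J -> y t = expR (- (k * t)) *: y 0.
Proof.
move=> Slin xy J0 xc xd t tJ.
have dotyx u s : S s -> edge_dot (y u) s = edge_dot (x u) s.
  exact: edge_dot_orthproj (xy u).
apply/eqP; rewrite -subr_eq0; apply/eqP/edge_dot_eq0.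
set s := y t - _.
have Ss : S s by apply: Slin; [exact: (xy t).1|exact: (xy 0).1].
rewrite {1}/s edge_dotBl edge_dotZl !dotyx//; apply/eqP; rewrite subr_eq0.
apply/eqP; apply: (exponential_decay (J := J)
                                     (g := fun u => edge_dot (x u) s)) => //.
  by move=> u; exact: cvg_comp (xc u) (edge_dot_continuous s (x u)).
by move=> u /xd[dx xdx /(_ _ Ss) <-]; exact: is_derive_edge_dot.
Qed.

Lemma cut_spaceB_scale {R : realType} {n m} {G : orgraph n m} (a : R) {u v} :
  cut_space G u -> cut_space G v -> cut_space G (u - a *: v).
Proof.
move=> [p _ <-] [q _ <-]; exists (p - a *: q) => //.
by rewrite mulmxBr scalemxAr.
Qed.

Lemma harmonic_spaceB_scale {R : realType} {n m} {G : orgraph n m} (a : R)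
    {u v} :
  harmonic_space G u -> harmonic_space G v -> harmonic_space G (u - a *: v).
Proof.
rewrite /harmonic_space /= => u0 v0.
by rewrite mulmxBr -scalemxAr u0 v0 scaler0 subrr.
Qed.

Lemma cut_proj_orthproj {R : realType} {n m} (G : orgraph n m) (x : 'cV[R]_m) :
  is_orthproj (cut_space G) x (cut_proj G x).
Proof.
have [c [h [cC hH ->]]] := cut_harmonic_exists G x.
rewrite (cut_harmonic_decomposition cC hH).1; split=> // s sC.
by rewrite [c + h]addrC addrK edge_dotC; exact: cut_harmonic_orthogonal sC hH.
Qed.

Lemma harmonic_proj_orthproj {R : realType} {n m} (G : orgraph n m)
    (x : 'cV[R]_m) : is_orthproj (harmonic_space G) x (harmonic_proj G x).
Proof.
have [c [h [cC hH ->]]] := cut_harmonic_exists G x.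
rewrite (cut_harmonic_decomposition cC hH).2; split=> // s sH.
by rewrite addrK; exact: cut_harmonic_orthogonal cC sH.
Qed.

Theorem theorem7p1 (R : realType) (n m : nat) (G : orgraph n m)
  (connG : connected_graph G)
  (fstar : 'cV[R]_m) (fstarC : cut_space G fstar)
  (alpha kappa : R) (alpha_gt0 : 0 < alpha) (kappa_gt0 : 0 < kappa)
  (J : interval R) (J0 : 0 \in J) (f : R -> 'cV[R]_m)
  (fsol : loop_damping_solution G alpha kappa fstar J f) :
  let fC t := cut_proj G (f t) in
  let fH t := harmonic_proj G (f t) in
  [/\ (forall t : R, t \in J ->
         fC t - fstar = expR (- (alpha * t)) *: (fC 0 - fstar)),
      (forall t : R, t \in J -> fH t = expR (- (kappa * t)) *: fH 0),
      (forall t : R, t \in J ->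
         edge_norm (fH t) = expR (- (kappa * t)) * edge_norm (fH 0)) &
      (fC 0 = fstar -> forall t : R, t \in J -> fC t = fstar)].
Proof.
move=> fC fH; have [fc fd] := fsol.
have cutP := @cut_proj_orthproj R n m G.
have harP := @harmonic_proj_orthproj R n m G.
have dampC t : t \in J ->
    fC t - fstar = expR (- (alpha * t)) *: (fC 0 - fstar).
  apply: (orthproj_decay (J := J) (x := fun u => f u - fstar)
                         (y := fun u => fC u - fstar) cut_spaceB_scale) => //.
  - move=> u; split=> [|s sC].
      have := cut_spaceB_scale 1 (cutP (f u)).1 fstarC; rewrite scale1r.
      exact.
    by rewrite opprB addrA subrK (cutP _).2.
  - by move=> u; apply: cvgB; [exact: fc|exact: cvg_cst].
  move=> u /fd fdu; eexists; first by apply: is_deriveB.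
  move=> s sC; rewrite subr0 [in LHS]edge_dotBl edge_dotNl !edge_dotZl.
  rewrite (edge_dot_orthproj (cutP _) sC).
  rewrite [edge_dot (harmonic_proj _ _) _]edge_dotC.
  by rewrite (cut_harmonic_orthogonal sC (harP _).1) mulr0 subr0 mulNr.
have dampH t : t \in J -> fH t = expR (- (kappa * t)) *: fH 0.
  apply: (orthproj_decay (J := J) (x := f) (y := fH)
                         harmonic_spaceB_scale) => //.
  move=> u /fd fdu; eexists; first exact: fdu.
  move=> s sH; rewrite edge_dotBl edge_dotNl !edge_dotZl.
  rewrite (cut_harmonic_orthogonal (cutP _).1 sH).
  by rewrite (edge_dot_orthproj (harP _) sH) mulr0 oppr0 sub0r mulNr.
split=> // [t tJ|fC0 t tJ].
  by rewrite dampH// edge_normZ ger0_norm ?expR_ge0.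
by apply/eqP; rewrite -subr_eq0 dampC// fC0 subrr scaler0.
Qed.
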